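(* There exists a constant $c>0$ such that for every modulus of continuity $\omega$, for every $f\in\Lambda_\omega$, and for arbitrary unitary operators $U$ and $V$ on Hilbert space, the following inequality holds: $$\|f(U)-f(V)\|\le c\,\|f\|_{\Lambda_\omega}\,\omega_*\big(\|U-V\|\big).$$
   Context: A modulus of continuity is a nondecreasing continuous function $\omega$ on $[0,\infty)$ such that $\omega(0)=0$, $\omega(x)>0$ for $x>0$, and $\omega(x+y)\le\omega(x)+\omega(y)$ for $x,y\in[0,\infty)$. $\Lambda_\omega$ is the space of functions $f$ on the unit circle $\mathbb T$ with $$\|f\|_{\Lambda_\omega}=\sup_{\zeta\ne\tau}\frac{|f(\zeta)-f(\tau)|}{\omega(|\zeta-\tau|)}<\infty .$$ For $x>0$, $\omega_*(x)=x\int_x^\infty\frac{\omega(t)}{t^2}\,dt$ (possibly $+\infty$), and $\omega_*(0)=0$. *)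

(* Defs.v *)
From HB Require Import structures.
From mathcomp Require Import all_boot all_order all_algebra.
From mathcomp Require Import complex.
From mathcomp Require Import all_classical all_reals all_analysis.

Set Implicit Arguments.
Unset Strict Implicit.
Unset Printing Implicit Defensive.

Import Order.TTheory GRing.Theory Num.Def Num.Theory.
Import numFieldNormedType.Exports.

Local Open Scope classical_set_scope.
Local Open Scope ring_scope.
Local Open Scope complex_scope.

Section Moduli.
Context {R : realType}.

(* Only the values of omega on [0, +oo[ matter. *)
Record modulus_of_continuity (omega : R -> R) : Prop := ModulusOfContinuity {
  modulus_nondecreasing :
    forall x y : R, 0 <= x -> x <= y -> omega x <= omega y;
  modulus_continuous : {within `[0, +oo[, continuous omega};
  modulus0 : omega 0 = 0;
  modulus_gt0 : forall x : R, 0 < x -> 0 < omega x;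
  modulus_subadditive : forall x y : R, 0 <= x -> 0 <= y ->
    omega (x + y) <= omega x + omega y }.

Definition omega_star (omega : R -> R) (x : R) : \bar R :=
  if x == 0 then 0%E
  else (x%:E * \int[lebesgue_measure]_(t in `]x, +oo[)
                 (omega t / t ^+ 2)%:E)%E.

(* The norm of a normed space over R[i] takes its values in R[i]; rnorm is the
   same nonnegative number seen in R. *)
Definition rnorm {V : normedZmodType R[i]} (x : V) : R := complex.Re `|x|.

Definition circle : Type := {z : R[i] | `|z| == 1}.

Definition Lambda_norm (omega : R -> R) (f : circle -> R[i]) : \bar R :=
  ereal_sup [set (rnorm (f p.1 - f p.2) /
                  omega (rnorm (val p.1 - val p.2)))%:E
            | p in [set p : circle * circle | p.1 <> p.2]].

Definition Lambda (omega : R -> R) : set (circle -> R[i]) :=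
  [set f | (Lambda_norm omega f < +oo)%E].

(* The trigonometric polynomial z |-> \sum_(-n <= k <= n) a_k z^k. *)
Definition trig_poly (n : nat) (a : int -> R[i]) (z : circle) : R[i] :=
  \sum_(i < n.*2.+1) a (i%:Z - n%:Z) * val z ^ (i%:Z - n%:Z).

End Moduli.

Arguments circle R : clear implicits.

Section Operators.
Context {R : realType} {H : completeNormedModType R[i]}.

(* A complex Hilbert space is a complete normed space whose norm comes from
   an inner product (linear in its first argument). *)
Definition norm_from_dot (dot : {dot H for conjC}) : Prop :=
  forall x : H, `|x| ^+ 2 = dot x x.

Definition opnorm (A : H -> H) : \bar R :=
  ereal_sup [set (rnorm (A x))%:E | x in [set x : H | `|x| <= 1]].

Record unitary (dot : {dot H for conjC}) : Type := Unitary {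
  unitary_op :> {linear H -> H};
  unitary_adj : {linear H -> H};
  unitary_adjP : forall x y : H,
    dot (unitary_op x) y = dot x (unitary_adj y);
  unitary_opK : forall x : H, unitary_adj (unitary_op x) = x;
  unitary_adjK : forall x : H, unitary_op (unitary_adj x) = x }.

Context {dot : {dot H for conjC}}.

Definition unitary_pow (U : unitary dot) (k : int) (x : H) : H :=
  match k with
  | Posz m => iter m (unitary_op U) x
  | Negz m => iter m.+1 (unitary_adj U) x
  end.

Definition trig_poly_op (n : nat) (a : int -> R[i]) (U : unitary dot)
    (x : H) : H :=
  \sum_(i < n.*2.+1) a (i%:Z - n%:Z) *: unitary_pow U (i%:Z - n%:Z) x.

(* The continuous functional calculus: A = f(U) when A is the limit in operator
   norm of p(U) along trigonometric polynomials p tending to f uniformly on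
   the circle. For f continuous and U unitary there is exactly one such A,
   because ||p(U)|| <= max |p| and trigonometric polynomials are dense in the
   continuous functions. *)
Definition is_fun_calculus (f : circle R -> R[i]) (U : unitary dot)
    (A : H -> H) : Prop :=
  forall eps : R, 0 < eps -> exists (n : nat) (a : int -> R[i]),
    (forall z : circle R, `|f z - trig_poly n a z| <= eps%:C) /\
    (forall x : H, `|A x - trig_poly_op n a U x| <= eps%:C * `|x|).

Definition fun_calculus (f : circle R -> R[i]) (U : unitary dot) : H -> H :=
  xget (fun=> 0) [set A | is_fun_calculus f U A].

End Operators.

(* Main.v *)
Require Import Defs.
From HB Require Import structures.
From mathcomp Require Import all_boot all_order all_algebra.
From mathcomp Require Import cyclic separable cyclotomic complex.
From mathcomp Require Import all_classical all_reals all_analysis measurable_realfun.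
From mathcomp Require Import zify ring lra.
Import Order.TTheory GRing.Theory Num.Def Num.Theory.
Import numFieldNormedType.Exports.
Local Open Scope classical_set_scope.
Local Open Scope ring_scope.

(* For a polynomial p of size L, U^k - V^k telescopes, so <(p(U) - p(V)) x, y> is a
   Hankel form sum_(i, l) p_(i + l) <u_i, v_l>. Sampling p at roots of unity splits
   such a form into rank one pieces, and Cauchy-Schwarz with Parseval bounds it by
   max |p|. This gives the operator Bernstein inequality
   |p(U) - p(V)| <= C deg(p) max |p| |U - V| and, in the same way,
   |p(U)| <= 2 max |p|. Approximating f by Jackson means p_k of degree about 2^k,
   with error O(omega(2^-k)), and applying these bounds to the increments
   p_(k+1) - p_k for 2^k <= 1 / |U - V| and to f - p_K for the last index K, one
   gets |f(U) - f(V)| <= C (omega(2^-K) + |U - V| sum_(k < K) 2^k omega(2^-k)),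
   a dyadic Riemann sum for omega_*(|U - V|). *)

Set Implicit Arguments.
Unset Strict Implicit.
Unset Printing Implicit Defensive.

(** * Roots of unity: orthogonality and discrete Parseval *)

Section RootsOfUnity.
Context {C : numClosedFieldType}.
Implicit Types (z : C) (P : {poly C}).

(** [X^M - 1] is separable in characteristic 0, so it has M distinct roots, and M distinct M-th
    roots of unity include a primitive one. *)
Lemma prim_root_exists (M : nat) : (0 < M)%N -> exists z : C, M.-primitive_root z.
Proof.
move=> M_gt0; pose p : {poly C} := 'X^M - 1.
have [r Dp] := closed_field_poly_normal p.
move: Dp; rewrite (monicP _) ?monicXnsubC // scale1r => Dp.
have rn1 : all M.-unity_root r by apply/allP=> z; rewrite -root_prod_XsubC -Dp.
have sz_r : (M < (size r).+1)%N by rewrite -(size_prod_XsubC r id) -Dp size_XnsubC.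
have [|z] := hasP (has_prim_root M_gt0 rn1 _ sz_r); last by exists z.
by rewrite -separable_prod_XsubC -Dp separable_Xn_sub_1 // pnatr_eq0 -lt0n.
Qed.

Lemma norm_unity_root (M : nat) z : (0 < M)%N -> z ^+ M = 1 -> `|z| = 1.
Proof.
move=> M_gt0 zM; apply/eqP; rewrite -(@pexpr_eq1 _ _ M) ?normr_ge0 -?lt0n //.
by rewrite -normrX zM normr1.
Qed.

Lemma conj_norm1 z : `|z| = 1 -> z^* = z^-1.
Proof. by move=> z1; rewrite invC_norm z1 expr1n invr1 mul1r. Qed.

Lemma sum_unity_root (M : nat) z : z ^+ M = 1 -> z != 1 -> \sum_(m < M) z ^+ m = 0.
Proof.
move=> zM z1; apply: (mulfI (x := 1 - z)); first by rewrite subr_eq0 eq_sym.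
by rewrite mulr0 -[1 - z]opprB mulNr -subrX1 zM subrr oppr0.
Qed.

(** Orthogonality of the characters of Z/M: conjugation inverts roots of unity, so the summands are
    the powers of [z^(i - l)], and their geometric sum vanishes unless this ratio is 1. *)
Lemma sum_prim_root (M : nat) z (i l : nat) : M.-primitive_root z ->
  \sum_(m < M) (z ^+ m) ^+ i * ((z ^+ m) ^+ l)^* = (i == l %[mod M])%:R * M%:R.
Proof.
move=> prz; have M_gt0 := prim_order_gt0 prz.
have z1 : `|z| = 1 by apply: norm_unity_root M_gt0 (prim_expr_order prz).
have z0 : z != 0 by rewrite -normr_gt0 z1.
under eq_bigr => m _ do
  rewrite !rmorphXn /= conj_norm1 // -!exprM !(mulnC m) !exprM -exprMn.
have [il|il] := eqVneq (i %% M)%N (l %% M)%N.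
  have zil : z ^+ i = z ^+ l by apply/eqP; rewrite (eq_prim_root_expr prz) il.
  under eq_bigr => m _ do rewrite zil -exprMn mulfV // !expr1n.
  by rewrite sumr_const card_ord mul1r.
rewrite mul0r sum_unity_root //.
  rewrite exprMn -!exprM [(i * M)%N]mulnC [(l * M)%N]mulnC !exprM exprVn.
  by rewrite (prim_expr_order prz) invr1 !expr1n mulr1.
apply: contra il => /eqP zil; rewrite -(eq_prim_root_expr prz).
apply/eqP; apply: (mulIf (x := z^-1 ^+ l)); rewrite ?expf_neq0 ?invr_eq0 //.
by rewrite zil -exprMn mulfV // expr1n.
Qed.

(** Indices below [A <= M] are distinct modulo M, so only the diagonal survives. The free weight [w]
    serves both the scalar and the vector-valued Parseval identity. *)
Lemma sum_prim_root_sesqui (M A : nat) z (w : nat -> nat -> C) :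
  M.-primitive_root z -> (A <= M)%N ->
  \sum_(m < M) \sum_(i < A) \sum_(l < A) (z ^+ m) ^+ i * ((z ^+ m) ^+ l)^* * w i l
  = M%:R * \sum_(i < A) w i i.
Proof.
move=> prz AM; rewrite exchange_big mulr_sumr; apply: eq_bigr => i _ /=.
rewrite exchange_big (bigD1 i) //= [X in _ + X]big1 => [|l li].
  by rewrite addr0 -mulr_suml sum_prim_root // eqxx mul1r.
rewrite -mulr_suml sum_prim_root // !modn_small ?(leq_trans _ AM) //.
by rewrite eq_sym (inj_eq val_inj) (negbTE li) !mul0r.
Qed.

(** The right-hand side is free of [w]: sums over rotated sample points all agree, which later makes
    the normalisation of the Jackson kernel exact. *)
Lemma parseval_poly (M : nat) z w P : M.-primitive_root z -> (size P <= M)%N ->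
  `|w| = 1 ->
  \sum_(m < M) `|P.[w * z ^+ m]| ^+ 2 = M%:R * \sum_(k < M) `|P`_k| ^+ 2.
Proof.
move=> prz sP w1; transitivity (\sum_(m < M) \sum_(i < M) \sum_(l < M)
    (z ^+ m) ^+ i * ((z ^+ m) ^+ l)^* * (P`_i * w ^+ i * (P`_l * w ^+ l)^*)).
  apply: eq_bigr => m _; rewrite normCK (horner_coef_wide _ sP) rmorph_sum mulr_suml.
  apply: eq_bigr => i _; rewrite mulr_sumr; apply: eq_bigr => l _.
  by rewrite !exprMn !rmorphM /=; ring.
rewrite (sum_prim_root_sesqui (fun i l => P`_i * w ^+ i * (P`_l * w ^+ l)^*)) //.
congr (_ * _); apply: eq_bigr => k _.
by rewrite -normCK normrM normrX w1 expr1n mulr1.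
Qed.

End RootsOfUnity.

(** * Cauchy-Schwarz and Hankel forms over an inner product *)

Section DotForms.
Context {C : numClosedFieldType} {E : lmodType C}.
Variable dot : {dot E for conjC}.

Lemma dotZr (a : C) x y : dot x (a *: y) = a^* * dot x y.
Proof. by rewrite linearZr_LR. Qed.

Lemma dotC x y : dot y x = (dot x y)^*.
Proof. by rewrite hermC expr0 mul1r. Qed.

(** Cauchy-Schwarz in a finite direct sum of copies of E, from the nonnegativity of the squared norm
    of [Y a - S b]. *)
Lemma sum_dot_cauchy_schwarz (I : finType) (a b : I -> E) :
  `|\sum_i dot (a i) (b i)| ^+ 2
  <= (\sum_i dot (a i) (a i)) * (\sum_i dot (b i) (b i)).
Proof.
set S := \sum_i dot (a i) (b i); set X := \sum_i _; set Y := \sum_i _.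
have Y_ge0 : 0 <= Y by apply: sumr_ge0 => i _; exact: dnorm_ge0.
have Yr : Y^* = Y by apply: geC0_conj.
have : 0 <= \sum_i dot (Y *: a i - S *: b i) (Y *: a i - S *: b i).
  by apply: sumr_ge0 => i _; exact: dnorm_ge0.
under eq_bigr => i _ do
  rewrite linearBl !linearBr !linearZl_LR /= !dotZr (dotC (a i) (b i)).
have -> : \sum_i (Y * (Y^* * dot (a i) (a i)) - Y * (S^* * dot (a i) (b i))
   - (S * (Y^* * (dot (a i) (b i))^*) - S * (S^* * dot (b i) (b i))))
   = Y * (X * Y - `|S| ^+ 2).
  rewrite !sumrB /= -!mulr_sumr -rmorph_sum -/S -/X -/Y Yr normCK.
  by ring.
(* A factor [Y] has to be cancelled. If [Y = 0], every [b i] is 0, hence so is [S]. *)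
have [Y0|Y0] := eqVneq Y 0; last first.
  by rewrite pmulr_rge0 ?subr_ge0 // lt_def Y0.
move=> _; suff -> : S = 0.
  by rewrite normr0 expr0n mulr_ge0 // sumr_ge0 // => i _; exact: dnorm_ge0.
apply: big1 => i _; have /eqP : dot (b i) (b i) = 0.
  by apply/(psumr_eq0P _ Y0) => // j _; exact: dnorm_ge0.
by rewrite dnorm_eq0 => /eqP ->; rewrite linear0r.
Qed.

Lemma parseval_dot (M A : nat) (z : C) (u : nat -> E) :
  M.-primitive_root z -> (A <= M)%N ->
  \sum_(m < M) dot (\sum_(i < A) (z ^+ m) ^+ i *: u i)
                   (\sum_(i < A) (z ^+ m) ^+ i *: u i)
  = M%:R * \sum_(i < A) dot (u i) (u i).
Proof.
move=> prz AM; rewrite -(sum_prim_root_sesqui (fun i l => dot (u i) (u l)) prz AM).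
apply: eq_bigr => m _; rewrite linear_sumlz; apply: eq_bigr => i _.
rewrite linear_sumr; apply: eq_bigr => l _.
by rewrite linearZl_LR /= dotZr mulrA.
Qed.

(* Sampling [r] at the [M]-th roots of unity splits the Hankel form into a sum of
   [M] rank one forms, to which Cauchy-Schwarz and Parseval apply. *)
Lemma hankel_form_bound (r : {poly C}) (K : C) (A B : nat) (u v : nat -> E) :
  (forall z : C, `|z| = 1 -> `|r.[z]| <= K) ->
  `|\sum_(i < A) \sum_(l < B) r`_(i + l) * dot (u i) (v l)| ^+ 2
  <= K ^+ 2 * (\sum_(i < A) dot (u i) (u i)) * (\sum_(l < B) dot (v l) (v l)).
Proof.
(* [M] exceeds every exponent of [r] and every [i + l], so congruence modulo [M] between them is
   equality and sampling causes no aliasing. *)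
move=> rK; pose M := (size r + A + B).+1.
have [z prz] := @prim_root_exists C _ (ltn0Sn (size r + A + B)).
have z1 m : `|z ^+ m| = 1.
  by rewrite normrX (norm_unity_root _ (prim_expr_order prz)) // expr1n.
have AM : (A <= M)%N by rewrite /M; lia.
have BM : (B <= M)%N by rewrite /M; lia.
have przc : M.-primitive_root (z^-1).
  by rewrite -conj_norm1 ?(z1 1) ?fmorph_primitive_root // -[z]expr1 z1.
(* [dot] is conjugate-linear on the right, so [z^-1] on the left and [z] on the right both
   contribute negative powers: the pair [(i, l)] carries [z^(-m (i + l))], and summing against
   [r.[z^m]] extracts [r_(i + l)]. *)
pose a (m : 'I_M) := \sum_(i < A) (z^-1 ^+ m) ^+ i *: u i.
pose b (m : 'I_M) := \sum_(l < B) (z ^+ m) ^+ l *: v l.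
have M0 : (M%:R : C) ^+ 2 > 0 by rewrite exprn_gt0 // ltr0n.
rewrite -(ler_pM2l M0) -{1}normr_nat -exprMn -normrM.
have -> : M%:R * (\sum_(i < A) \sum_(l < B) r`_(i + l) * dot (u i) (v l))
  = \sum_(m < M) dot (r.[z ^+ m] *: a m) (b m).
  under [RHS]eq_bigr => m _.
    rewrite linearZl_LR /= linear_sumlz mulr_sumr.
    under eq_bigr => i _.
      rewrite linear_sumr mulr_sumr.
      under eq_bigr => l _ do rewrite linearZl_LR /= dotZr.
      over.
    over.
  rewrite [RHS]exchange_big mulr_sumr; apply: eq_bigr => i _ /=.
  rewrite [RHS]exchange_big mulr_sumr; apply: eq_bigr => l _ /=.
  under eq_bigr => m _.
    rewrite (horner_coef_wide _ (leq_trans (leq_addr _ _) (leqnSn _)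
       : (size r <= (size r + (A + B)).+1)%N)) mulr_suml.
    over.
  rewrite exchange_big /=.
  have ilM : (i + l < (size r + (A + B)).+1)%N.
    by have := ltn_ord i; have := ltn_ord l; lia.
  rewrite (bigD1 (Ordinal ilM)) //= [X in _ + X]big1 ?addr0 => [|k kil].
    rewrite (eq_bigr (fun m : 'I_M => r`_(i + l) * dot (u i) (v l))).
      by rewrite sumr_const card_ord mulr_natl.
    move=> m _.
    have -> : (z^-1 ^+ m) = (z ^+ m)^-1 by rewrite exprVn.
    rewrite rmorphXn /= conj_norm1 // exprD.
    have zm0 : z ^+ m != 0 by rewrite -normr_gt0 z1.
    have e n : (z ^+ m) ^+ n * (z ^+ m)^-1 ^+ n = 1 by rewrite -exprMn mulfV ?expr1n.
    transitivity (r`_(i + l) * dot (u i) (v l) *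
      (((z ^+ m) ^+ i * (z ^+ m)^-1 ^+ i) * ((z ^+ m) ^+ l * (z ^+ m)^-1 ^+ l))).
      by ring.
    by rewrite !e !mulr1.
  transitivity (r`_k * dot (u i) (v l) *
     (\sum_(m < M) (z ^+ m) ^+ k * ((z ^+ m) ^+ (i + l))^*)).
    rewrite mulr_sumr; apply: eq_bigr => m _.
    have -> : (z^-1 ^+ m) = (z ^+ m)^* by rewrite exprVn conj_norm1.
    by rewrite exprD !rmorphM !rmorphXn; ring.
  rewrite sum_prim_root // !modn_small /M -?addnA //.
  by case: eqP => [kE|]; rewrite ?mul0r ?mulr0 //; case/eqP: kil; exact: val_inj.
apply: le_trans (sum_dot_cauchy_schwarz _ _) _.
rewrite parseval_dot //.
set X := \sum_(i < A) dot (u i) (u i); set Y := \sum_(l < B) dot (v l) (v l).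
have -> : M%:R ^+ 2 * (K ^+ 2 * X * Y) = K ^+ 2 * (M%:R * X) * (M%:R * Y).
  by ring.
apply: ler_wpM2r.
  by rewrite mulr_ge0 ?ler0n // sumr_ge0 // => l _; exact: dnorm_ge0.
rewrite -(parseval_dot u przc AM) mulr_sumr; apply: ler_sum => m _.
rewrite dnormZ ler_wpM2r ?dnorm_ge0 // lerXn2r ?nnegrE //.
  by apply: le_trans (rK _ (z1 0)).
exact: rK.
Qed.

End DotForms.

(** * Polynomials of a linear operator *)

Section OperatorPolynomials.
Context {C : numClosedFieldType} {E : lmodType C}.
Implicit Types (T : {linear E -> E}) (p q : {poly C}) (x y : E).

Definition op_poly p T x : E := \sum_(i < size p) p`_i *: iter i T x.

Lemma op_poly_wide p T x n : (size p <= n)%N ->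
  op_poly p T x = \sum_(i < n) p`_i *: iter i T x.
Proof.
move=> pn; rewrite /op_poly (big_ord_widen n (fun i => p`_i *: iter i T x)) //.
rewrite [RHS](bigID (fun i : 'I_n => (i < size p)%N)) /= [X in _ = _ + X]big1 ?addr0 //.
by move=> i; rewrite -leqNgt => /(nth_default 0) ->; rewrite scale0r.
Qed.

Lemma op_polyB p q T x : op_poly (p - q) T x = op_poly p T x - op_poly q T x.
Proof.
pose n := maxn (size p) (size q).
rewrite !(@op_poly_wide _ _ _ n) ?leq_maxl ?leq_maxr //; last first.
  by rewrite (leq_trans (size_polyD _ _)) // size_polyN.
by rewrite -sumrB; apply: eq_bigr => i _; rewrite coefB scalerBl.
Qed.

Lemma iterB T n x y : iter n T (x - y) = iter n T x - iter n T y.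
Proof. by elim: n => //= n ->; rewrite linearB. Qed.

Lemma iterZ T n a x : iter n T (a *: x) = a *: iter n T x.
Proof. by elim: n => //= n ->; rewrite linearZ. Qed.

Lemma iter_sum T n (I : Type) (r : seq I) (P : pred I) (F : I -> E) :
  iter n T (\sum_(i <- r | P i) F i) = \sum_(i <- r | P i) iter n T (F i).
Proof. by elim: n => //= n ->; rewrite linear_sum. Qed.

Lemma iter_op_poly p T n x : iter n T (op_poly p T x) = op_poly p T (iter n T x).
Proof.
rewrite /op_poly iter_sum; apply: eq_bigr => i _.
by rewrite iterZ -!iterD addnC.
Qed.

Lemma op_polyXnM p T n x : op_poly ('X^n * p) T x = iter n T (op_poly p T x).
Proof.
rewrite (@op_poly_wide _ _ _ (n + size p)); last first.
  by rewrite (leq_trans (size_polyMleq _ _)) // size_polyXn.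
rewrite big_split_ord /= big1 => [|i _]; last by rewrite coefXnM ltn_ord scale0r.
rewrite add0r /op_poly iter_sum; apply: eq_bigr => i _.
by rewrite coefXnM ltnNge leq_addr /= addKn iterZ iterD.
Qed.

End OperatorPolynomials.

(** * Norm bounds for polynomials and trigonometric polynomials of unitary operators *)

Section UnitaryPolynomials.
Context {R : realType} {H : completeNormedModType R[i]}.
Context {dot : {dot H for conjC}}.
Hypothesis normE : norm_from_dot dot.
Implicit Types (U V : unitary dot) (p q : {poly R[i]}) (x y : H) (K delta : R[i]).

Lemma norm_unitary U x : `|U x| = `|x|.
Proof.
by apply: (@pexpIrn _ 2); rewrite ?nnegrE // !normE unitary_adjP unitary_opK.
Qed.

Lemma norm_unitary_adj U x : `|unitary_adj U x| = `|x|.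
Proof. by rewrite -(norm_unitary U) unitary_adjK. Qed.

Lemma norm_iter_unitary U n x : `|iter n U x| = `|x|.
Proof. by elim: n => //= n IH; rewrite norm_unitary. Qed.

Lemma norm_iter_unitary_adj U n x : `|iter n (unitary_adj U) x| = `|x|.
Proof. by elim: n => //= n IH; rewrite norm_unitary_adj. Qed.

Lemma iter_unitaryK U n x : iter n (unitary_adj U) (iter n U x) = x.
Proof.
elim: n x => // n IH x.
by rewrite [iter n.+1 U x]iterS iterSr unitary_opK IH.
Qed.

Lemma iter_unitary_adjK U n x : iter n U (iter n (unitary_adj U) x) = x.
Proof.
elim: n x => // n IH x.
by rewrite [iter n.+1 (unitary_adj U) x]iterS iterSr unitary_adjK IH.
Qed.

Lemma dot_iter_unitary U n x y :
  dot (iter n U x) y = dot x (iter n (unitary_adj U) y).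
Proof. by elim: n x y => // n IH x y; rewrite iterS iterSr unitary_adjP IH. Qed.

Lemma sum_dot_le (u : nat -> H) n K : (forall i, `|u i| <= K) ->
  \sum_(i < n) dot (u i) (u i) <= n%:R * K ^+ 2.
Proof.
move=> uK; have -> : n%:R * K ^+ 2 = \sum_(i < n) K ^+ 2.
  by rewrite sumr_const card_ord mulr_natl.
apply: ler_sum => i _; rewrite -normE lerXn2r ?nnegrE //.
exact: le_trans (uK i).
Qed.

(** Replaces duality: testing the vector against itself is enough, as one factor [|x|] cancels. *)
Lemma norm_le_dot x K : 0 <= K -> `|dot x x| <= K * `|x| -> `|x| <= K.
Proof.
move=> K0; rewrite -normE normrX normr_id expr2.
have [-> _|x0] := eqVneq x 0; first by rewrite normr0.
by rewrite ler_pM2r // normr_gt0.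
Qed.

(* The exact constant is 1; any absolute constant suffices here, and 2 comes out
   of the Hankel bound without a limiting argument. *)
Lemma norm_op_poly_le U p K x : (forall z : R[i], `|z| = 1 -> `|p.[z]| <= K) ->
  `|op_poly p U x| <= 2 * K * `|x|.
Proof.
move=> pK; set y := op_poly p U x.
have K0 : 0 <= K by apply: le_trans (pK 1 (normr1 _)).
have [p0|p0] := eqVneq p 0.
  by rewrite /y /op_poly p0 size_poly0 big_ord0 normr0 !mulr_ge0.
pose L := size p; have L0 : (0 < L)%N by rewrite size_poly_gt0.
apply: norm_le_dot; first by rewrite !mulr_ge0.
(* For each [l], the sum over [i] is [<U^(L-l) p(U) x, U^(L-l) y> = |y|^2], so the form equals
   [L |y|^2]. The ranges [2 L] and [L] give the factor [sqrt 2], rounded up to 2. *)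
have := @hankel_form_bound _ _ dot ('X^L * p) K (2 * L) L
  (fun i => iter i U x) (fun l => iter (L - l) U y).
have -> : \sum_(i < 2 * L) \sum_(l < L) ('X^L * p)`_(i + l) *
    dot (iter i U x) (iter (L - l) U y) = L%:R * dot y y.
  have -> : L%:R * dot y y = \sum_(l < L) dot y y.
    by rewrite sumr_const card_ord mulr_natl.
  rewrite exchange_big /=.
  apply: eq_bigr => l _; have lL := ltn_ord l.
  have -> : dot y y = dot (iter (L - l) U y) (iter (L - l) U y).
    by rewrite dot_iter_unitary iter_unitaryK.
  rewrite {2}/y -op_polyXnM (@op_poly_wide _ _ _ _ _ (2 * L)); last first.
    by rewrite (leq_trans (size_polyMleq _ _)) // size_polyXn -/L; lia.
  rewrite linear_sumlz; apply: eq_bigr => i _; rewrite linearZl_LR /=; congr (_ * _).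
  rewrite !coefXnM; have -> : (i + l < L)%N = (i < L - l)%N by lia.
  by case: ifP => // _; congr (p`_ _); lia.
have bnd z : `|z| = 1 -> `|('X^L * p).[z]| <= K.
  by move=> z1; rewrite hornerM hornerXn normrM normrX z1 expr1n mul1r pK.
move=> /(_ bnd) {bnd} h.
have {}h : `|L%:R * dot y y| ^+ 2 <= (2 * K * `|x| * `|y| * L%:R) ^+ 2.
  apply: le_trans h _.
  have s1 : \sum_(i < 2 * L) dot (iter i U x) (iter i U x) <= (2 * L)%:R * `|x| ^+ 2.
    by apply: (@sum_dot_le (fun i => iter i U x)) => i; rewrite norm_iter_unitary.
  have s2 : \sum_(l < L) dot (iter (L - l) U y) (iter (L - l) U y) <= L%:R * `|y| ^+ 2.
    by apply: (@sum_dot_le (fun l => iter (L - l) U y)) => i; rewrite norm_iter_unitary.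
  have h0 n (u : nat -> H) : 0 <= \sum_(i < n) dot (u i) (u i).
    by apply: sumr_ge0 => i _; exact: dnorm_ge0.
  apply: (@le_trans _ _ (K ^+ 2 * ((2 * L)%:R * `|x| ^+ 2) * (L%:R * `|y| ^+ 2))).
    apply: ler_pM => //.
    - by apply: mulr_ge0; [exact: exprn_ge0|exact: h0].
    - exact: (h0 _ (fun l => iter (L - l) U y)).
    - by apply: ler_wpM2l => //; exact: exprn_ge0.
  have -> : (2 * K * `|x| * `|y| * L%:R) ^+ 2
      = 2 * (K ^+ 2 * ((2 * L)%:R * `|x| ^+ 2) * (L%:R * `|y| ^+ 2)).
    by rewrite natrM; ring.
  by rewrite ler_peMl ?ler1n // !mulr_ge0 ?exprn_ge0.
have Lp : (0 : R[i]) < L%:R by rewrite ltr0n.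
rewrite -(ler_pM2l Lp) -[X in X * `|dot _ _|]normr_nat -normrM.
have -> : L%:R * (2 * K * `|x| * `|y|) = 2 * K * `|x| * `|y| * L%:R by ring.
by rewrite -(@ler_pXn2r _ 2) // nnegrE ?normr_ge0 // !mulr_ge0.
Qed.

(** Grouping by [k = i + l]; the pairs with [i + l >= L] drop out because [p] has no coefficient
    there. *)
Lemma sum_antidiagonal (L : nat) p (g : nat -> nat -> R[i]) : (size p <= L)%N ->
  \sum_(i < L) \sum_(l < L) p`_(i + l) * g i l
  = \sum_(k < L) p`_k * \sum_(i < k.+1) g i (k - i)%N.
Proof.
move=> pL.
under [RHS]eq_bigr => k _ do
  rewrite (big_ord_widen L (fun i => g i (k - i)%N)) // mulr_sumr.
rewrite [RHS](exchange_big_dep xpredT) //=; apply: eq_bigr => i _.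
transitivity (\sum_(0 <= l < L) p`_(i + l) * g i l); first by rewrite big_mkord.
transitivity (\sum_(0 <= k < L | (i <= k)%N) p`_k * g i (k - i)%N);
  last by rewrite big_mkord.
rewrite (@big_cat_nat _ _ _ (L - i)) ?leq_subr //= [X in _ + X]big_nat_cond.
rewrite [X in _ + X]big1 ?addr0; last first.
  move=> l /andP[/andP[il _] _]; rewrite nth_default ?mul0r //.
  by apply: leq_trans pL _; rewrite -leq_subLR.
rewrite [RHS](@big_cat_nat _ _ _ i) //=; last exact: ltnW.
rewrite [X in _ = X + _]big_nat_cond [X in _ = X + _]big1 ?add0r; last first.
  by move=> k /andP[/andP[_ ki]]; rewrite leqNgt ki.
rewrite [RHS](_ : _ = \sum_(0 + i <= k < L | (i <= k)%N) p`_k * g i (k - i)%N) //.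
rewrite big_addn big_nat_cond [RHS]big_nat_cond.
by apply: eq_big => [l|l _]; rewrite ?leq_addl ?andbT // addnC addnK.
Qed.

(* U^k - V^k telescopes into sum_i U^(k-i) (U - V) V^(i-1), so that p(U) - p(V)
   becomes a Hankel form in the coefficients of p. *)
Lemma norm_op_polyB_le U V p K delta x :
  0 <= delta -> (forall y, `|U y - V y| <= delta * `|y|) ->
  (forall z : R[i], `|z| = 1 -> `|p.[z]| <= K) ->
  `|op_poly p U x - op_poly p V x| <= (size p)%:R * K * delta * `|x|.
Proof.
move=> d0 UVd pK; set y := _ - _.
have K0 : 0 <= K by apply: le_trans (pK 1 (normr1 _)).
pose L := size p.
(* The value 0 at index 0 pads the telescoping sum of [U^k - V^k] to the full antidiagonal
   [i + l = k]. *)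
pose u i : H := if i is j.+1 then U (iter j V x) - V (iter j V x) else 0.
have uE k : iter k U x - iter k V x = \sum_(i < k.+1) iter (k - i) U (u i).
  elim: k => [|k IH]; first by rewrite big_ord1 subrr.
  rewrite big_ord_recr /= subnn /=.
  under eq_bigr => i _ do rewrite subSn -1?ltnS //=.
  by rewrite -linear_sum -IH linearB addrA subrK.
apply: norm_le_dot; first by rewrite !mulr_ge0.
have -> : dot y y
    = \sum_(i < L) \sum_(l < L) p`_(i + l) * dot (u i) (iter l (unitary_adj U) y).
  rewrite (sum_antidiagonal (fun i l => dot (u i) (iter l (unitary_adj U) y))) //.
  rewrite {1}/y /op_poly -sumrB linear_sumlz; apply: eq_bigr => k _.
  rewrite -scalerBr linearZl_LR uE linear_sumlz /=; congr (_ * _).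
  by apply: eq_bigr => i _; rewrite dot_iter_unitary.
have := @hankel_form_bound _ _ dot p K L L u (fun l => iter l (unitary_adj U) y) pK.
set S := \sum_(i < L) \sum_(l < L) _ => h.
rewrite -(@ler_pXn2r _ 2) // ?nnegrE ?normr_ge0 ?mulr_ge0 //.
apply: le_trans h _.
have s1 : \sum_(i < L) dot (u i) (u i) <= L%:R * (delta * `|x|) ^+ 2.
  apply: sum_dot_le => -[|j] /=; first by rewrite normr0 mulr_ge0.
  by apply: le_trans (UVd _) _; rewrite norm_iter_unitary.
have s2 : \sum_(l < L) dot (iter l (unitary_adj U) y) (iter l (unitary_adj U) y)
    <= L%:R * `|y| ^+ 2.
  by apply: (@sum_dot_le (fun l => iter l (unitary_adj U) y)) => i; rewrite norm_iter_unitary_adj.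
have h0 n (v : nat -> H) : 0 <= \sum_(i < n) dot (v i) (v i).
  by apply: sumr_ge0 => i _; exact: dnorm_ge0.
apply: (@le_trans _ _ (K ^+ 2 * (L%:R * (delta * `|x|) ^+ 2) * (L%:R * `|y| ^+ 2))).
  apply: ler_pM => //.
  - by apply: mulr_ge0; [exact: exprn_ge0|exact: h0].
  - exact: (h0 _ (fun l => iter l (unitary_adj U) y)).
  - by apply: ler_wpM2l => //; exact: exprn_ge0.
by rewrite le_eqVlt; apply/orP; left; apply/eqP; rewrite /L; ring.
Qed.

Lemma norm_iterB_le U V delta n x : 0 <= delta ->
  (forall y, `|U y - V y| <= delta * `|y|) ->
  `|iter n U x - iter n V x| <= n%:R * delta * `|x|.
Proof.
move=> d0 UVd; elim: n => [|n IH]; first by rewrite subrr normr0 !mul0r.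
rewrite /= -[U _](subrK (U (iter n V x))) -linearB -addrA.
apply: le_trans (ler_normD _ _) _; rewrite norm_unitary -natr1 !mulrDl mul1r.
by rewrite lerD // (le_trans (UVd _)) // norm_iter_unitary.
Qed.

(** The trigonometric polynomial [z^-N p(z)] at [U]. Keeping the shift apart lets bounds on ordinary
    polynomials apply. *)
Definition op_trig (N : nat) p U x : H := iter N (unitary_adj U) (op_poly p U x).

Lemma norm_op_trig_le U N p K x : (forall z : R[i], `|z| = 1 -> `|p.[z]| <= K) ->
  `|op_trig N p U x| <= 2 * K * `|x|.
Proof. by rewrite norm_iter_unitary_adj; exact: norm_op_poly_le. Qed.

(** After applying [U^N], the difference becomes [(p(U) - p(V)) x + (V^N - U^N) p(V) V^-N x]; the
    Bernstein bound controls the first term, telescoping the second. *)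
Lemma norm_op_trigB_le U V N p K delta x :
  0 <= delta -> (forall y, `|U y - V y| <= delta * `|y|) ->
  (size p <= N.*2.+1)%N ->
  (forall z : R[i], `|z| = 1 -> `|p.[z]| <= K) ->
  `|op_trig N p U x - op_trig N p V x| <= 5 * N%:R * K * delta * `|x|.
Proof.
move=> d0 UVd pN pK; have K0 : 0 <= K by apply: le_trans (pK 1 (normr1 _)).
(* For [N = 0] the polynomial is constant and the difference is 0. For [N > 0], [2 N + 1 <= 3 N],
   which yields the constant [3 + 2 = 5]. *)
have [N0|N0] := posnP N.
  rewrite N0 in pN *; rewrite /op_trig /= !(@op_poly_wide _ _ _ _ _ 1) //.
  by rewrite !big_ord1 /= subrr normr0 mulr0 !mul0r.
rewrite -(norm_iter_unitary U N) iterB iter_unitary_adjK.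
pose x' := iter N (unitary_adj V) x.
have -> : op_trig N p V x = op_poly p V x'.
  by rewrite /op_trig -{1}[x](iter_unitary_adjK V N) -iter_op_poly iter_unitaryK.
rewrite -[op_poly p U x](subrK (op_poly p V x)) -addrA.
have -> : op_poly p V x = iter N V (op_poly p V x').
  by rewrite iter_op_poly iter_unitary_adjK.
apply: le_trans (ler_normD _ _) _.
have b2 : `|iter N V (op_poly p V x') - iter N U (op_poly p V x')|
    <= N%:R * delta * (2 * K * `|x|).
  rewrite distrC; apply: le_trans (norm_iterB_le _ _ d0 UVd) _.
  rewrite ler_wpM2l ?mulr_ge0 //; apply: le_trans (norm_op_poly_le _ _ pK) _.
  by rewrite norm_iter_unitary_adj.
rewrite {1}iter_op_poly iter_unitary_adjK.
apply: le_trans (lerD (norm_op_polyB_le _ d0 UVd pK) b2) _.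
apply: (@le_trans _ _ ((3 * N)%:R * K * delta * `|x| + N%:R * delta * (2 * K * `|x|))).
  rewrite lerD2r !ler_wpM2r // ler_nat (leq_trans pN) //; lia.
by rewrite natrM le_eqVlt; apply/orP; left; apply/eqP; ring.
Qed.

(** Brings two trigonometric polynomials to a common shift, so that they can be subtracted. *)
Lemma op_trig_widen U N M p x : op_trig (M + N) ('X^M * p) U x = op_trig N p U x.
Proof. by rewrite /op_trig op_polyXnM addnC iterD iter_unitaryK. Qed.

Lemma op_trigB U N p q x : op_trig N (p - q) U x = op_trig N p U x - op_trig N q U x.
Proof. by rewrite /op_trig op_polyB iterB. Qed.

Lemma unitary_pow_subn U (i n : nat) x :
  unitary_pow U (i%:Z - n%:Z) x = iter n (unitary_adj U) (iter i U x).
Proof.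
have [ni|ni] := leqP n i.
  by rewrite subzn //= -[in RHS](subnKC ni) iterD iter_unitaryK.
have -> : i%:Z - n%:Z = Negz (n - i).-1.
  by rewrite NegzE prednK ?subn_gt0 // -subzn ?opprB // ltnW.
rewrite /unitary_pow prednK ?subn_gt0 //.
by rewrite -[in RHS](subnK (ltnW ni)) iterD iter_unitaryK.
Qed.

Lemma trig_poly_opE U n (a : int -> R[i]) p x :
  (size p <= n.*2.+1)%N -> (forall i, (i < n.*2.+1)%N -> a (i%:Z - n%:Z) = p`_i) ->
  trig_poly_op n a U x = op_trig n p U x.
Proof.
move=> pn ap; rewrite /trig_poly_op /op_trig (op_poly_wide _ _ pn) iter_sum.
by apply: eq_bigr => i _; rewrite unitary_pow_subn iterZ ap.
Qed.

End UnitaryPolynomials.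

Lemma trig_polyE {R : realType} n (a : int -> R[i]) (p : {poly R[i]}) (z : circle R) :
  (size p <= n.*2.+1)%N -> (forall i, (i < n.*2.+1)%N -> a (i%:Z - n%:Z) = p`_i) ->
  trig_poly n a z = val z ^- n * p.[val z].
Proof.
move=> pn ap; rewrite /trig_poly (horner_coef_wide _ pn) mulr_sumr.
have z0 : val z != 0 by rewrite -normr_gt0 (eqP (valP z)).
apply: eq_bigr => i _; rewrite ap // expfzDr // mulrCA -exprnP exprnN.
by rewrite mulrCA [RHS]mulrCA; congr (_ * _); exact: mulrC.
Qed.

(** * Moduli of continuity and Jackson approximation on the circle *)

Section Jackson.
Context {R : realType}.
Implicit Types (omega : R -> R) (f : circle R -> R[i]).

Lemma rnormE (V : normedZmodType R[i]) (x : V) : (rnorm x)%:C%C = `|x|.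
Proof. by rewrite /rnorm RRe_real // normr_real. Qed.

Lemma rnorm_ge0 (V : normedZmodType R[i]) (x : V) : 0 <= rnorm x.
Proof. by rewrite -ler0c rnormE. Qed.

Lemma modulus_ge0 omega (x : R) : modulus_of_continuity omega -> 0 <= x -> 0 <= omega x.
Proof.
by move=> [mono _ w0 _ _] x0; rewrite -w0; apply: mono.
Qed.

Lemma modulusMn omega (h : R) (m : nat) :
  modulus_of_continuity omega -> 0 <= h -> omega (m%:R * h) <= m%:R * omega h.
Proof.
move=> [_ _ w0 _ sub] h0; elim: m => [|m IH]; first by rewrite !mul0r w0.
rewrite -natr1 !mulrDl !mul1r (le_trans (sub _ _ _ _)) ?mulr_ge0 //.
by rewrite lerD2r.
Qed.

(** Subadditivity gives [omega r <= m omega(1/n)] with [m <= n r + 1]. The quadratic majorant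
    reduces the Jackson error to a second moment of the kernel. *)
Lemma modulus_quadratic omega (r : R) (n : nat) :
  modulus_of_continuity omega -> 0 <= r -> (0 < n)%N ->
  omega r <= omega n%:R^-1 * (2 + n%:R ^+ 2 * r ^+ 2).
Proof.
move=> w r0 n0; have n0' : (0 : R) < n%:R by rewrite ltr0n.
have w0 : 0 <= omega n%:R^-1 by rewrite modulus_ge0 // invr_ge0 ltW.
pose m := (Num.truncn (r * n%:R)).+1.
have rm : r <= m%:R * n%:R^-1.
  by rewrite ler_pdivlMr // ltW // truncnS_gt.
apply: le_trans (modulus_nondecreasing w r0 rm) _.
apply: le_trans (modulusMn _ w _) _; first by rewrite invr_ge0 ltW.
rewrite mulrC ler_wpM2l // /m -natr1.
have : (Num.truncn (r * n%:R))%:R <= r * n%:R by rewrite truncn_le ?mulr_ge0.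
have := sqr_ge0 (r * n%:R - 1); nra.
Qed.

Lemma modulus_small omega (eps : R) : modulus_of_continuity omega ->
  0 < eps -> exists k : nat, omega (2 ^+ k)^-1 <= eps.
Proof.
move=> w e0; have [_ /continuous_within_itvcyP[_ c0] w0 _ _] := w.
move: c0; rewrite w0 => /cvgrPdist_lt /(_ _ e0) [d /= d0 hd].
pose k := (Num.truncn d^-1).+1; exists k.
have k0 : 0 < (2 ^+ k)^-1 :> R by rewrite invr_gt0 exprn_gt0.
have kd : (2 ^+ k)^-1 < d.
  rewrite invf_plt ?posrE ?exprn_gt0 //; apply: lt_trans (truncnS_gt _) _.
  by rewrite -/k -natrX ltr_nat; exact: ltn_expl.
have := hd (2 ^+ k)^-1; rewrite /= !sub0r !normrN gtr0_norm // => /(_ kd k0).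
by rewrite ger0_norm ?(modulus_ge0 w) ?(ltW k0) // => /ltW.
Qed.

(** The one-sided Dirichlet kernel [sum_(k < n) (z t)^k], as a polynomial in [z]. *)
Definition dirichlet (n : nat) (t : R[i]) : {poly R[i]} := \poly_(k < n) t ^+ k.

Lemma size_dirichlet n t : (size (dirichlet n t) <= n)%N.
Proof. exact: size_poly. Qed.

Lemma horner_dirichlet n (t z : R[i]) :
  (dirichlet n t).[z] = \sum_(k < n) (z * t) ^+ k.
Proof.
rewrite horner_poly; apply: eq_bigr => k _.
by rewrite exprMn mulrC.
Qed.

(** On the circle, conjugating and reversing the sum multiplies it by [t^-(n-1)]. The unnormalised
    Fejer kernel is thus a shift times a polynomial. *)
Lemma dirichlet_fejer n (t : R[i]) : (0 < n)%N -> `|t| = 1 ->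
  `|\sum_(k < n) t ^+ k| ^+ 2 = t ^- n.-1 * (\sum_(k < n) t ^+ k) ^+ 2.
Proof.
case: n => // n _ t1; rewrite normCK /= [RHS]mulrC expr2 -mulrA; congr (_ * _).
rewrite rmorph_sum mulr_suml (reindex_inj rev_ord_inj) /=; apply: eq_bigr => k _.
have t0 : t != 0 by rewrite -normr_gt0 t1.
rewrite rmorphXn /= conj_norm1 // subSS exprVn exprB ?unitfE //; last by rewrite -ltnS.
by rewrite invf_div.
Qed.

(* The Jackson kernel is the square of the Fejer kernel, sampled at the [2 n]-th roots of
   unity: |1 - t|^2 |d(t)|^4 = |1 - t^n|^2 |d(t)|^2 bounds its second moment. *)
Lemma jackson_approximation omega f (Lam : R) (n : nat) :
  modulus_of_continuity omega -> 0 <= Lam ->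
  (forall z w, `|f z - f w| <= (Lam * omega (rnorm (val z - val w)))%:C%C) ->
  (0 < n)%N -> let N := n.-1.*2 in
  exists q : {poly R[i]}, (size q <= N.*2.+1)%N /\
    forall z, `|f z - val z ^- N * q.[val z]| <= (10 * Lam * omega n%:R^-1)%:C%C.
Proof.
move=> w Lam0 fL n0 N.
have M0 : (0 < 2 * n)%N by rewrite muln_gt0.
have [x prx] := @prim_root_exists R[i] _ M0.
have x1 : `|x| = 1 by exact: norm_unity_root (prim_expr_order prx).
have xn1 m : `|x ^+ m| = 1 by rewrite normrX x1 expr1n.
have xn0 m : x ^+ m != 0 by rewrite -normr_gt0 xn1.
have spt m : `|(x ^+ m)^-1| == 1 by rewrite normfV xn1 invr1.
(* The nodes are inverses because the kernel depends on [z x^m], which equals 1 exactly at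
   [z = s m]. *)
pose s m : circle R := Sub (x ^+ m)^-1 (spt m).
pose d (t : R[i]) := \sum_(k < n) t ^+ k.
pose T := \sum_(m < 2 * n) `|d (x ^+ m)| ^+ 4.
have dE t z : (dirichlet n t).[z] = d (z * t) by exact: horner_dirichlet.
(* The total mass [T] does not depend on [z]: this is Parseval for the square of the Dirichlet
   kernel, of size at most [2 n]. *)
have sumk (z : R[i]) : `|z| = 1 -> \sum_(m < 2 * n) `|d (z * x ^+ m)| ^+ 4 = T.
  have h (y : R[i]) : `|y| = 1 -> \sum_(m < 2 * n) `|d (y * x ^+ m)| ^+ 4 =
      (2 * n)%:R * \sum_(k < 2 * n) `|(dirichlet n 1 ^+ 2)`_k| ^+ 2.
    move=> y1; rewrite -(parseval_poly prx _ y1); last first.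
      apply: leq_trans (size_poly_exp_leq _ _) _.
      by move: (size _) (size_dirichlet n 1) n0 => a; clear; lia.
    by apply: eq_bigr => m _; rewrite horner_exp dE mulr1 normrX -exprM.
  move=> z1; rewrite h // -(h 1) ?normr1 //.
  by apply: eq_bigr => m _; rewrite mul1r.
have sum2 (z : R[i]) : `|z| = 1 -> \sum_(m < 2 * n) `|d (z * x ^+ m)| ^+ 2 = (2 * n * n)%:R.
  move=> z1; transitivity (\sum_(m < 2 * n) `|(dirichlet n 1).[z * x ^+ m]| ^+ 2).
    by apply: eq_bigr => m _; rewrite dE mulr1.
  rewrite (parseval_poly prx _ z1); last by rewrite (leq_trans (size_poly _ _)) // leq_pmull.
  rewrite [RHS]natrM; congr (_ * _).
  rewrite mul2n -addnn big_split_ord /= [X in _ + X]big1 ?addr0.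
    rewrite (eq_bigr (fun=> 1)) ?sumr_const ?card_ord // => k _.
    by rewrite coef_poly ltn_ord expr1n normr1 expr1n.
  by move=> k _; rewrite coef_poly ltnNge leq_addr /= normr0 expr0n.
(* At [z = 1], the node [m = 0] alone contributes [n^4]. *)
have Tn : (n ^ 4)%:R <= T.
  rewrite /T (bigD1 (Ordinal M0)) //= expr0 ler_wpDr //.
    by apply: sumr_ge0 => m _; rewrite exprn_ge0.
  rewrite /d (eq_bigr (fun=> 1)) => [|k _]; last by rewrite expr1n.
  by rewrite sumr_const card_ord normr_nat natrX.
have T0 : 0 < T by apply: lt_le_trans Tn; rewrite ltr0n expn_gt0 n0.
pose q := T^-1 *: \sum_(m < 2 * n)
  (f (s m) * (x ^+ m) ^- N) *: dirichlet n (x ^+ m) ^+ 4.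
exists q; split.
  apply: leq_trans (size_scale_leq _ _) _.
  apply: leq_trans (size_sum _ _ _) _; apply/bigmax_leqP => m _.
  apply: leq_trans (size_scale_leq _ _) _.
  apply: leq_trans (size_poly_exp_leq _ _) _.
  by rewrite /N; move: (size _) (size_dirichlet n (x ^+ m)) n0 => a; clear; lia.
move=> z; have z1 : `|val z| = 1 by exact/eqP/(valP z).
have kE m : `|d (val z * x ^+ m)| ^+ 4
    = val z ^- N * (x ^+ m) ^- N * (dirichlet n (x ^+ m) ^+ 4).[val z].
  rewrite horner_exp dE -[4%N]/(2 * 2)%N !exprM dirichlet_fejer // ?normrM ?z1 ?xn1 ?mulr1 //.
  rewrite exprMn; congr (_ * _).
  by rewrite exprVn -[X in X^-1 = _]exprM muln2 -/N exprMn invfM.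
(* The kernel weights divided by [T] sum to 1, so [f z] can be moved inside the mean. *)
have -> : f z - val z ^- N * q.[val z] =
  T^-1 * \sum_(m < 2 * n) `|d (val z * x ^+ m)| ^+ 4 * (f z - f (s m)).
  rewrite hornerZ horner_sum.
  under [in RHS]eq_bigr => m _ do rewrite mulrBr.
  rewrite sumrB -mulr_suml sumk // mulrBr mulKf ?gt_eqF //.
  congr (_ - _); rewrite mulrCA mulr_sumr; congr (_ * _); apply: eq_bigr => m _.
  by rewrite hornerZ kE; ring.
set W : R[i] := (Lam * omega n%:R^-1)%:C%C.
have W0 : 0 <= W by rewrite ler0c mulr_ge0 // modulus_ge0 // invr_ge0.
have fs m : `|f z - f (s m)| <= W * (2 + n%:R ^+ 2 * `|1 - val z * x ^+ m| ^+ 2).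
  apply: le_trans (fL _ _) _.
  have -> : `|1 - val z * x ^+ m| = `|val z - val (s m)|.
    transitivity (`|val z - val (s m)| * `|x ^+ m|); last by rewrite xn1 mulr1.
    by rewrite -normrM mulrBl /= mulVf // distrC.
  rewrite -rnormE; set r := rnorm _.
  have -> : (2 : R[i]) + n%:R ^+ 2 * r%:C%C ^+ 2 = (2 + n%:R ^+ 2 * r ^+ 2)%:C%C.
    by rewrite rmorphD rmorphM !rmorphXn !rmorph_nat.
  rewrite /W -rmorphM lecR -mulrA ler_wpM2l //.
  by apply: modulus_quadratic => //; exact: rnorm_ge0.
rewrite normrM ger0_norm ?invr_ge0 ?(ltW T0) // mulrC ler_pdivrMr //.
apply: le_trans (ler_norm_sum _ _ _) _.
apply: (@le_trans _ _ (\sum_(m < 2 * n) (2 * W * `|d (val z * x ^+ m)| ^+ 4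
   + 4 * W * n%:R ^+ 2 * `|d (val z * x ^+ m)| ^+ 2))).
  apply: ler_sum => m _; set t := val z * x ^+ m.
  rewrite normrM ger0_norm ?exprn_ge0 //.
  apply: (le_trans (ler_wpM2l _ (fs m))); first by rewrite exprn_ge0.
  (* The geometric sum gives [(1 - t) d(t) = 1 - t^n]. *)
  have td : `|1 - t| * `|d t| <= 2.
    rewrite -normrM /d -[1 - t]opprB mulNr -subrX1 opprB.
    apply: le_trans (ler_normB _ _) _.
    by rewrite normr1 normrX normrM z1 xn1 mulr1 expr1n.
  have td2 : (`|1 - t| * `|d t|) ^+ 2 <= 4.
    have -> : (4 : R[i]) = 2 ^+ 2 by rewrite expr2 -natrM.
    by rewrite lerXn2r // nnegrE // mulr_ge0.
  have -> : `|d t| ^+ 4 * (W * (2 + n%:R ^+ 2 * `|1 - t| ^+ 2)) =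
    2 * W * `|d t| ^+ 4 + (`|1 - t| * `|d t|) ^+ 2 * (W * n%:R ^+ 2 * `|d t| ^+ 2).
    by ring.
  have -> : 4 * W * n%:R ^+ 2 * `|d t| ^+ 2 = 4 * (W * n%:R ^+ 2 * `|d t| ^+ 2) by ring.
  by rewrite lerD2l ler_wpM2r // !mulr_ge0 // exprn_ge0.
rewrite big_split /= -!mulr_sumr sumk // sum2 //.
(* The constant is [10 = 2 + 8]: the second-moment term is [4 n^2] times [2 n^2], that is
   [8 n^4 <= 8 T]. *)
have -> : (10 * Lam * omega n%:R^-1)%:C%C * T = 2 * W * T + 8 * W * T.
  by rewrite -mulrA rmorphM rmorph_nat -/W; ring.
rewrite lerD2l.
have -> : 4 * W * n%:R ^+ 2 * (2 * n * n)%:R = 8 * W * (n ^ 4)%:R.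
  by rewrite natrX !natrM; ring.
by rewrite ler_wpM2l // mulr_ge0.
Qed.

End Jackson.

(** * Existence of the functional calculus and the dyadic estimate for it *)

Section FunctionalCalculusEstimate.
Context {R : realType} {H : completeNormedModType R[i]}.
Context {dot : {dot H for conjC}}.
Hypothesis normE : norm_from_dot dot.
Implicit Types (U V : unitary dot) (x y : H).

Section TrigDifference.
Variables (N M : nat) (p q : {poly R[i]}) (K : R[i]).
Hypothesis pqK : forall z : R[i], `|z| = 1 -> `|z ^- N * p.[z] - z ^- M * q.[z]| <= K.

(** [z^(M+N)] times the difference of the two trigonometric polynomials: an ordinary polynomial of
    the same modulus on the circle. *)
Let r : {poly R[i]} := 'X^M * p - 'X^N * q.

Let rK (z : R[i]) : `|z| = 1 -> `|r.[z]| <= K.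
Proof.
move=> z1; have z0 : z != 0 by rewrite -normr_gt0 z1.
have -> : r.[z] = z ^+ (M + N) * (z ^- N * p.[z] - z ^- M * q.[z]).
  rewrite hornerD hornerN !hornerM !hornerXn mulrBr exprD.
  congr (_ - _); first by rewrite -mulrA mulVKf ?expf_neq0.
  by rewrite [z ^+ M * _]mulrC -mulrA mulVKf ?expf_neq0.
by rewrite normrM normrX z1 expr1n mul1r pqK.
Qed.

Let rE U x : op_trig N p U x - op_trig M q U x = op_trig (M + N) r U x.
Proof.
by rewrite op_trigB op_trig_widen (addnC M) op_trig_widen.
Qed.

Lemma op_trig_dist U x : `|op_trig N p U x - op_trig M q U x| <= 2 * K * `|x|.
Proof. by rewrite rE; exact: norm_op_trig_le. Qed.

Lemma op_trig_dist2 U V (delta : R[i]) x : 0 <= delta ->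
  (forall y, `|U y - V y| <= delta * `|y|) ->
  (size p <= N.*2.+1)%N -> (size q <= M.*2.+1)%N ->
  `|(op_trig N p U x - op_trig M q U x) - (op_trig N p V x - op_trig M q V x)|
  <= 5 * (M + N)%:R * K * delta * `|x|.
Proof.
move=> d0 UVd pN qM; rewrite !rE; apply: norm_op_trigB_le => //.
rewrite (leq_trans (size_polyD _ _)) // geq_max size_polyN.
rewrite !(leq_trans (size_polyMleq _ _)) // size_polyXn /=.
  by apply: leq_trans (leq_add (leqnn _) qM) _; lia.
by apply: leq_trans (leq_add (leqnn _) pN) _; lia.
Qed.

End TrigDifference.

Variables (omega : R -> R) (f : circle R -> R[i]) (Lam : R).
Hypothesis w : modulus_of_continuity omega.
Hypothesis Lam0 : 0 <= Lam.
Hypothesis fL :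
  forall z1 z2, `|f z1 - f z2| <= (Lam * omega (rnorm (val z1 - val z2)))%:C%C.

(** The Jackson error for [n = 2^k]; [N k] below is the corresponding shift. *)
Let E (k : nat) : R := 10 * Lam * omega (2 ^+ k)^-1.
Let N (k : nat) : nat := (2 ^ k).-1.*2.

Let E_ge0 k : 0 <= E k.
Proof. by rewrite !mulr_ge0 // (modulus_ge0 w) // invr_ge0 exprn_ge0. Qed.

Let E_nincr k l : (k <= l)%N -> E l <= E k.
Proof.
move=> kl; rewrite ler_wpM2l ?mulr_ge0 //; apply: (modulus_nondecreasing w).
  by rewrite invr_ge0 exprn_ge0.
by rewrite lef_pV2 ?posrE ?exprn_gt0 // ler_weXn2l // ler1n.
Qed.

Let E_small (eps : R) : 0 < eps -> exists k, E k <= eps.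
Proof.
(* The [+ 1] keeps the denominator positive when [Lam = 0]. *)
move=> e0; have e1 : 0 < eps / (10 * Lam + 1) by rewrite divr_gt0 // ltr_wpDl ?mulr_ge0.
have [k kE] := modulus_small w e1; exists k.
have := kE; rewrite ler_pdivlMr ?ltr_wpDl ?mulr_ge0 // mulrDr mulr1 [omega _ * _]mulrC -/(E k).
apply: le_trans; rewrite lerDl (modulus_ge0 w) // invr_ge0 exprn_ge0.
Qed.

Let jackson_dyadic : exists q : nat -> {poly R[i]}, forall k,
  (size (q k) <= (N k).*2.+1)%N /\
  forall z, `|f z - val z ^- N k * (q k).[val z]| <= (E k)%:C%C.
Proof.
have h k : exists qk : {poly R[i]}, (size qk <= (N k).*2.+1)%N /\
    forall z, `|f z - val z ^- N k * qk.[val z]| <= (E k)%:C%C.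
  have k0 : (0 < 2 ^ k)%N by rewrite expn_gt0.
  have [q [sq qE]] := jackson_approximation w Lam0 fL k0; exists q; split=> // z.
  by rewrite (le_trans (qE z)) // /E natrX.
by have [q qE] := choice h; exists q.
Qed.

Section Approximants.
Variable q : nat -> {poly R[i]}.
Hypothesis sizeq : forall k, (size (q k) <= (N k).*2.+1)%N.
Hypothesis approxq :
  forall k z, `|f z - val z ^- N k * (q k).[val z]| <= (E k)%:C%C.

Let T k U x : H := op_trig (N k) (q k) U x.

Let circle_diff (n m : nat) (p r : {poly R[i]}) (a b : R) :
  (forall z : circle R, `|f z - val z ^- n * p.[val z]| <= a%:C%C) ->
  (forall z : circle R, `|f z - val z ^- m * r.[val z]| <= b%:C%C) ->
  forall z : R[i], `|z| = 1 -> `|z ^- n * p.[z] - z ^- m * r.[z]| <= (a + b)%:C%C.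
Proof.
move=> pa rb z /eqP z1; pose z' : circle R := Sub z z1.
rewrite -(subrKA (f z')).
apply: le_trans (ler_normD _ _) _; rewrite rmorphD lerD //.
by rewrite distrC; exact: (pa z').
Qed.

Let T_dist k l U x : `|T k U x - T l U x| <= (2 * (E k + E l))%:C%C * `|x|.
Proof.
by rewrite rmorphM rmorph_nat; apply: op_trig_dist; apply: circle_diff.
Qed.

Let T_incr k U V (delta : R) x : 0 <= delta ->
  (forall y, `|U y - V y| <= delta%:C%C * `|y|) ->
  `|(T k.+1 U x - T k U x) - (T k.+1 V x - T k V x)|
  <= (600 * Lam * delta * (2 ^+ k * omega (2 ^+ k)^-1))%:C%C * `|x|.
Proof.
move=> d0 UVd; have d0' : 0 <= delta%:C%C by rewrite ler0c.
apply: le_trans (op_trig_dist2 (circle_diff (approxq k.+1) (approxq k)) _ d0' UVd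
  (sizeq k.+1) (sizeq k)) _.
rewrite ler_wpM2r //.
have -> : 5 * (N k + N k.+1)%:R * (E k.+1 + E k)%:C%C * delta%:C%C =
    (5 * (N k + N k.+1)%:R * (E k.+1 + E k) * delta)%:C%C.
  by rewrite !rmorphM !rmorph_nat.
rewrite lecR.
(* [N k + N k.+1 <= 6 * 2^k] and [E k.+1 + E k <= 2 E k], hence [600 = 5 * 6 * 2 * 10]. *)
have -> : 600 * Lam * delta * (2 ^+ k * omega (2 ^+ k)^-1)
   = 5 * (6 * 2 ^ k)%:R * (2 * E k) * delta.
  by rewrite /E natrM natrX; ring.
apply: ler_wpM2r => //; apply: ler_pM.
- by rewrite mulr_ge0.
- by rewrite addr_ge0.
- by rewrite ler_pM2l // ler_nat /N expnS; lia.
by rewrite mulr_natl mulr2n lerD2r E_nincr.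
Qed.

(** [N 0 = 0], so [q 0] is a constant polynomial: the telescoping in [k] starts from a zero
    difference. *)
Let T0_const U V x : T 0 U x = T 0 V x.
Proof.
rewrite /T /op_trig /= !(@op_poly_wide _ _ _ _ _ 1) ?(sizeq 0) //.
by rewrite !big_ord1.
Qed.

Let T_lip K U V (delta : R) x : 0 <= delta ->
  (forall y, `|U y - V y| <= delta%:C%C * `|y|) ->
  `|T K U x - T K V x|
  <= (600 * Lam * delta * \sum_(k < K) 2 ^+ k * omega (2 ^+ k)^-1)%:C%C * `|x|.
Proof.
move=> d0 UVd; elim: K => [|K IH].
  by rewrite (T0_const U V) subrr normr0 big_ord0 mulr0 mul0r.
rewrite big_ord_recr /= mulrDr rmorphD mulrDl.
have -> : T K.+1 U x - T K.+1 V x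
    = (T K U x - T K V x) + ((T K.+1 U x - T K U x) - (T K.+1 V x - T K V x)).
  rewrite opprB [RHS]addrC -addrA.
  by rewrite [T K V x - T K.+1 V x + _]addrC !subrKA.
apply: le_trans (ler_normD _ _) _; rewrite lerD //; exact: T_incr.
Qed.

Lemma fun_calculus_approx U A k x : is_fun_calculus f U A ->
  `|A x - T k U x| <= (2 * E k)%:C%C * `|x|.
Proof.
move=> fA; rewrite -!rnormE -rmorphM lecR; apply/ler_addgt0Pr => e e0.
(* The comparison below costs [e' + 2 (e' + E k)], so [3 e' |x|] must stay below [e]; the [+ 1]
   covers [x = 0]. *)
pose e' := e / (3 * (rnorm x + 1)).
have x1 : 0 < rnorm x + 1 by rewrite ltr_wpDl ?rnorm_ge0.
have e'0 : 0 < e' by rewrite divr_gt0 // mulr_gt0.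
have [n [a [fa Aa]]] := fA _ e'0.
pose p : {poly R[i]} := \poly_(i < n.*2.+1) a (i%:Z - n%:Z).
have sp : (size p <= n.*2.+1)%N by exact: size_poly.
have ap i : (i < n.*2.+1)%N -> a (i%:Z - n%:Z) = p`_i by move=> in_; rewrite coef_poly in_.
have fa' z : `|f z - val z ^- n * p.[val z]| <= e'%:C%C by rewrite -(trig_polyE z sp ap).
have h1 := Aa x; rewrite (trig_poly_opE _ _ sp ap) in h1.
have h2 := op_trig_dist (circle_diff fa' (approxq k)) U x.
have h3 : `|A x - T k U x| <= (e' + 2 * (e' + E k))%:C%C * `|x|.
  rewrite rmorphD mulrDl -[A x](subrK (op_trig n p U x)) -addrA.
  apply: le_trans (ler_normD _ _) _; rewrite lerD //.
  by rewrite rmorphM rmorph_nat.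
move: h3; rewrite -!rnormE -rmorphM lecR => /le_trans; apply.
have e'E : e' * (3 * (rnorm x + 1)) = e by rewrite /e' divfK // gt_eqF // mulr_gt0.
rewrite -e'E; have := rnorm_ge0 x; nra.
Qed.

(** [T k U x] is Cauchy in [k], and its limit is approximated uniformly on the unit ball. Without
    existence, [fun_calculus] would be the default value 0. *)
Lemma is_fun_calculus_exists U : exists A, is_fun_calculus f U A.
Proof.
have cT x : cvgn (fun k => T k U x).
  apply: cauchy_cvg; apply: cauchy_exP => eps eps0.
  have epsE : (complex.Re eps)%:C%C = eps by rewrite RRe_real // gtr0_real.
  have eps0' : 0 < complex.Re eps by rewrite -ltcR epsE.
  have x1 : 0 < rnorm x + 1 by rewrite ltr_wpDl ?rnorm_ge0.
  have [|k kE] := @E_small (complex.Re eps / (4 * (rnorm x + 1))).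
    by rewrite divr_gt0 // mulr_gt0.
  exists (T k U x); exists k => // l /= kl; rewrite -ball_normE /=.
  apply: le_lt_trans (T_dist _ _ _ _) _.
  rewrite -epsE -rnormE -rmorphM ltcR.
  have := E_nincr kl; move: kE; rewrite ler_pdivlMr ?mulr_gt0 //.
  have := rnorm_ge0 x; have := E_ge0 k; have := E_ge0 l; nra.
pose A x := limn (fun k => T k U x).
have AT x k : `|A x - T k U x| <= (4 * E k)%:C%C * `|x|.
  apply/ler_addgt0Pr => e e0.
  have /cvgrPdist_lt /(_ _ e0) [l _ lA] := cT x.
  have kl := leq_maxl k l; have ll := leq_maxr k l.
  rewrite -[A x](subrK (T (maxn k l) U x)) -addrA addrC.
  apply: le_trans (ler_normD _ _) _; rewrite lerD //; last first.
    by apply/ltW/(lA (maxn k l)).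
  apply: le_trans (T_dist _ _ _ _) _; rewrite ler_wpM2r // lecR.
  by have := E_nincr kl; lra.
exists A => eps eps0; have [|k kE] := @E_small (eps / 4); first by rewrite divr_gt0.
(* Adding [N k] turns the exponents from [- N k] to [N k] into coefficient indices of [q k]. *)
exists (N k), (fun j => (q k)`_(absz (j + (N k)%:Z))).
have ap i : (i < (N k).*2.+1)%N -> (q k)`_(absz (i%:Z - (N k)%:Z + (N k)%:Z)) = (q k)`_i.
  by move=> _; rewrite subrK absz_nat.
split=> [z|x].
  rewrite (trig_polyE z (sizeq k) ap); apply: le_trans (approxq k z) _.
  by rewrite lecR; have := E_ge0 k; lra.
rewrite (trig_poly_opE _ _ (sizeq k) ap); apply: le_trans (AT x k) _.
by rewrite ler_wpM2r // lecR; lra.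
Qed.

(** Passing through [T K U x] and [T K V x]: the two outer errors [2 E K] add up to
    [40 Lam omega(2^-K)], and [T_lip] bounds the middle term. *)
Lemma fun_calculusB_approx K U V (delta : R) x : 0 <= delta ->
  (forall y, `|U y - V y| <= delta%:C%C * `|y|) ->
  `|fun_calculus f U x - fun_calculus f V x| <=
  (Lam * (40 * omega (2 ^+ K)^-1
          + 600 * (delta * \sum_(k < K) 2 ^+ k * omega (2 ^+ k)^-1)))%:C%C * `|x|.
Proof.
move=> d0 UVd.
have fc (W : unitary dot) : is_fun_calculus f W (fun_calculus f W).
  have [A fA] := is_fun_calculus_exists W.
  rewrite /fun_calculus.
  by apply: (xgetPex _ (P := [set A | is_fun_calculus f W A])); exists A.
have hU := fun_calculus_approx K x (fc U); have hV := fun_calculus_approx K x (fc V).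
have hT := T_lip K x d0 UVd.
set S := \sum_(k < K) _ in hT *.
have -> : fun_calculus f U x - fun_calculus f V x =
    (fun_calculus f U x - T K U x) + (T K U x - T K V x) + (T K V x - fun_calculus f V x).
  by rewrite !addrA !subrK.
apply: le_trans (ler_normD _ _) _.
rewrite distrC in hV.
apply: le_trans (lerD (le_trans (ler_normD _ _) (lerD hU hT)) hV) _.
rewrite -!mulrDl -!rmorphD ler_wpM2r // lecR le_eqVlt; apply/orP; left; apply/eqP.
by rewrite /E; ring.
Qed.

End Approximants.

Lemma norm_fun_calculusB_le K U V (delta : R) x : 0 <= delta ->
  (forall y, `|U y - V y| <= delta%:C%C * `|y|) ->
  `|fun_calculus f U x - fun_calculus f V x| <=
  (Lam * (40 * omega (2 ^+ K)^-1
          + 600 * (delta * \sum_(k < K) 2 ^+ k * omega (2 ^+ k)^-1)))%:C%C * `|x|.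
Proof.
have [q qE] := jackson_dyadic; apply: (@fun_calculusB_approx q) => k.
  by have [] := qE k.
by have [] := qE k.
Qed.

End FunctionalCalculusEstimate.

(** * Comparison of the dyadic sum with [omega_star] *)

Section OmegaStar.
Context {R : realType}.
Variable omega : R -> R.
Hypothesis w : modulus_of_continuity omega.
Local Notation mu := (@lebesgue_measure R).

Let g (t : R) : \bar R := (omega t / t ^+ 2)%:E.

Lemma measurable_omega_div (a : R) : 0 < a -> measurable_fun `]a, +oo[ g.
Proof.
move=> a0; apply/measurable_EFinP; apply: open_continuous_measurable_fun.
  exact: interval_open.
move=> t; rewrite inE /= in_itv /= andbT => at_.
have t0 : 0 < t by exact: lt_trans at_.
have [_ /continuous_within_itvcyP[wc _] _ _ _] := w.
apply: cvgM; first by apply: wc; rewrite in_itv /= t0.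
apply: cvgV; first by rewrite expf_neq0 // gt_eqF.
exact: exprn_continuous.
Qed.

Let g_ge0 (a t : R) : 0 < a -> `]a, +oo[%classic t -> (0 <= g t)%E.
Proof.
move=> a0; rewrite /= in_itv /= andbT => at_; have t0 := lt_trans a0 at_.
by rewrite lee_fin divr_ge0 ?exprn_ge0 ?(modulus_ge0 w) // ltW.
Qed.

Definition omega_tail (a : R) : \bar R := (\int[mu]_(t in `]a, +oo[) g t)%E.

Lemma omega_tail_ge0 a : 0 < a -> (0 <= omega_tail a)%E.
Proof. by move=> a0; apply: integral_ge0 => t; exact: g_ge0. Qed.

Lemma omega_tail_nincr a b : 0 < a -> a <= b -> (omega_tail b <= omega_tail a)%E.
Proof.
move=> a0 ab; apply: ge0_subset_integral => //.
- exact: measurable_omega_div.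
- by move=> t; exact: g_ge0.
- by move=> t /=; rewrite !in_itv /= !andbT; exact: le_lt_trans.
Qed.

(** On []a, 2 a]], of length [a], the integrand is at least [omega a / (2 a)^2]. *)
Lemma omega_tail_double (a : R) : 0 < a ->
  ((omega a / (4 * a))%:E + omega_tail (2 * a) <= omega_tail a)%E.
Proof.
move=> a0.
have a2 : a < 2 * a by rewrite mulr_natl mulr2n ltrDl.
have U : `]a, +oo[%classic = `]a, (2 * a)] `|` `](2 * a), +oo[ :> set R.
  apply/seteqP; split => t /=; rewrite !in_itv /= !andbT.
    by move=> ->; case: (leP t (2 * a)) => _; [left|right].
  by case=> [/andP[]//|]; exact: lt_trans.
rewrite /omega_tail U ge0_integral_setU //=; first last.
- apply/disj_setPS => t /= [] /[!in_itv] /= /andP[_ t1]; rewrite andbT => t2.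
  by move: (le_lt_trans t1 t2); rewrite ltxx.
- by move=> t t_; apply: (g_ge0 a0); rewrite U.
- by have := measurable_omega_div a0; rewrite U.
rewrite leeD2r //.
have -> : (omega a / (4 * a))%:E =
    (\int[mu]_(t in `]a, (2 * a)%R]) (cst (omega a / (2 * a) ^+ 2)%R%:E) t)%E.
  rewrite integral_cst //= lebesgue_measure_itv /= lte_fin a2 -EFinD -EFinM; congr (_%:E).
  by field; rewrite gt_eqF.
apply: ge0_le_integral => //=.
- by move=> t _; rewrite lee_fin divr_ge0 ?exprn_ge0 ?(modulus_ge0 w) ?mulr_ge0 ?(ltW a0).
- apply: (@measurable_funS _ _ _ _ `]a, +oo[%classic) => //; last exact: measurable_omega_div.
  by move=> t /=; rewrite !in_itv /= andbT => /andP[].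
- move=> t; rewrite /= in_itv /= => /andP[at_ t2].
  have t0 := lt_trans a0 at_.
  rewrite lee_fin; apply: ler_pM.
  - by rewrite (modulus_ge0 w) // ltW.
  - by rewrite invr_ge0 exprn_ge0 // mulr_ge0 // ltW.
  - by apply: (modulus_nondecreasing w); exact: ltW.
  - by rewrite lef_pV2 ?posrE ?exprn_gt0 ?mulr_gt0 // lerXn2r ?nnegrE // ltW // mulr_gt0.
Qed.

(** Each step splits off []2^-K, 2 * 2^-K]]. The endpoint [2 / 2^K] becomes [2^-K] at [K.+1], where
    the doubling bound applies. *)
Lemma omega_tail_ge_sum (K : nat) :
  ((\sum_(k < K) 2 ^+ k * omega (2 ^+ k)^-1 / 4)%:E <= omega_tail (2 / 2 ^+ K))%E.
Proof.
elim: K => [|K IH]; first by rewrite big_ord0 omega_tail_ge0 // divr1.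
have k0 : 0 < (2 ^+ K)^-1 :> R by rewrite invr_gt0 exprn_gt0.
have -> : 2 / 2 ^+ K.+1 = (2 ^+ K)^-1 :> R by rewrite exprS invfM mulrA mulfV ?mul1r.
apply: le_trans (omega_tail_double k0).
rewrite big_ord_recr /= EFinD addeC leeD //.
by rewrite lee_fin invfM invrK le_eqVlt; apply/orP; left; apply/eqP; ring.
Qed.

Lemma omega_starE x : 0 < x -> omega_star omega x = (x%:E * omega_tail x)%E.
Proof. by move=> x0; rewrite /omega_star gt_eqF. Qed.

(** Both [omega x / 4] and a quarter of [x] times the dyadic sum lie below [omega_star omega x],
    whence [160 = 4 * 40] and [2400 = 4 * 600]. *)
Lemma dyadic_sum_le_omega_star (x : R) (K : nat) : 0 < x ->
  (2 ^+ K)^-1 <= x -> x <= 2 / 2 ^+ K ->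
  ((40 * omega (2 ^+ K)^-1 + 600 * (x * \sum_(k < K) 2 ^+ k * omega (2 ^+ k)^-1))%:E
   <= (160 + 2400)%:E * omega_star omega x)%E.
Proof.
move=> x0 Kx xK; rewrite omega_starE //.
have x4 : ((omega x / 4)%:E <= x%:E * omega_tail x)%E.
  apply: (@le_trans _ _ (x%:E * (omega x / (4 * x))%:E)%E).
    by rewrite -EFinM lee_fin le_eqVlt; apply/orP; left; apply/eqP; field; rewrite gt_eqF.
  rewrite lee_pmul2l // ; apply: le_trans (omega_tail_double x0).
  by rewrite leeDl // omega_tail_ge0 // mulr_gt0.
have s4 : ((x * \sum_(k < K) 2 ^+ k * omega (2 ^+ k)^-1 / 4)%:E <= x%:E * omega_tail x)%E.
  rewrite EFinM lee_pmul2l //; apply: le_trans (omega_tail_ge_sum K) _.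
  by apply: omega_tail_nincr.
(* [Y] may be infinite, so distributivity rests on the signs of [a] and [b]. *)
have muleDl (a b : R) (Y : \bar R) : 0 <= a -> 0 <= b ->
    ((a + b)%:E * Y = a%:E * Y + b%:E * Y)%E.
  by move=> a0 b0; rewrite EFinD ge0_muleDl ?lee_fin.
rewrite muleDl; [|exact: ler0n|exact: ler0n].
rewrite EFinD; apply: leeD.
- have c0 : (0 <= 160%:E :> \bar R)%E by rewrite lee_fin ler0n.
  apply: le_trans (lee_wpmul2l c0 x4).
  rewrite -EFinM lee_fin.
  have : omega (2 ^+ K)^-1 <= omega x.
    by apply: (modulus_nondecreasing w) => //; rewrite invr_ge0 exprn_ge0.
  lra.
- have c0 : (0 <= 2400%:E :> \bar R)%E by rewrite lee_fin ler0n.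
  apply: le_trans (lee_wpmul2l c0 s4).
  rewrite -EFinM lee_fin -mulr_suml; set S := \sum_(k < K) _.
  lra.
Qed.

End OmegaStar.

(** * The operator norm of a difference of unitaries *)

Section OperatorNorm.
Context {R : realType} {H : completeNormedModType R[i]}.
Context {dot : {dot H for conjC}}.
Hypothesis normE : norm_from_dot dot.
Implicit Types (U V : unitary dot) (x : H).

(** Gives finiteness of the norm and the upper limit 2 required by [dyadic_bracket]. *)
Lemma opnorm_unitaryB_le2 U V : (opnorm (fun x : H => (U x - V x)%R) <= 2%:E)%E.
Proof.
apply: ge_ereal_sup => _ [x /= x1 <-]; rewrite lee_fin -lecR rnormE rmorph_nat.
apply: le_trans (ler_normB _ _) _; rewrite !(norm_unitary normE).
by rewrite -[2]/(1 + 1) lerD.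
Qed.

Lemma opnorm_ge0 (A : H -> H) : (0 <= opnorm A)%E.
Proof.
apply: (@le_trans _ _ (rnorm (A 0))%:E); first by rewrite lee_fin rnorm_ge0.
by apply: ereal_sup_ubound; exists 0 => //=; rewrite normr0.
Qed.

Lemma opnorm_unitaryB_fin U V : opnorm (fun x : H => (U x - V x)%R) \is a fin_num.
Proof.
by rewrite ge0_fin_numE ?opnorm_ge0 // (le_lt_trans (opnorm_unitaryB_le2 U V)) // ltry.
Qed.

Lemma norm_unitaryB_le_opnorm U V x :
  `|U x - V x| <= (fine (opnorm (fun x : H => (U x - V x)%R)))%:C%C * `|x|.
Proof.
have lin0 (W : unitary dot) : W 0 = 0 by exact: linear0.
have linZ (W : unitary dot) a y : W (a *: y) = a *: W y by exact: linearZ_LR.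
have [->|x0] := eqVneq x 0; first by rewrite !lin0 subrr !normr0 mulr0.
have nx : 0 < `|x| by rewrite normr_gt0.
rewrite -ler_pdivrMr //.
have -> : `|U x - V x| / `|x| = `|U (`|x|^-1 *: x) - V (`|x|^-1 *: x)|.
  by rewrite !linZ -scalerBr normrZ normfV normr_id mulrC.
rewrite -rnormE lecR -lee_fin fineK ?opnorm_unitaryB_fin //.
apply: ereal_sup_ubound; exists (`|x|^-1 *: x) => //=.
by rewrite normrZ normfV normr_id mulVf // gt_eqF.
Qed.

End OperatorNorm.

(** * The seminorm of [Lambda] as a Lipschitz-type constant *)

Section LambdaNorm.
Context {R : realType}.
Variables (omega : R -> R) (f : circle R -> R[i]).
Hypothesis w : modulus_of_continuity omega.

Lemma Lambda_norm_ge0 : (0 <= Lambda_norm omega f)%E.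
Proof.
(* The points 1 and -1 show that the supremum runs over a nonempty set; over an empty one it would
   be [-oo]. *)
have h1 : `|1 : R[i]| == 1 by rewrite normr1.
pose z1 : circle R := exist (fun z : R[i] => `|z| == 1) 1 h1.
have h : `|- 1 : R[i]| == 1 by rewrite normrN normr1.
pose z2 : circle R := exist (fun z : R[i] => `|z| == 1) (- 1) h.
apply: (@le_trans _ _ (rnorm (f z1 - f z2) / omega (rnorm (val z1 - val z2)))%:E).
  by rewrite lee_fin divr_ge0 ?rnorm_ge0 // (modulus_ge0 w) // rnorm_ge0.
apply: ereal_sup_ubound; exists (z1, z2) => //= /(congr1 val) /= /eqP.
by rewrite -subr_eq0 opprK -[1 + 1]/(2%:R) pnatr_eq0.
Qed.

Lemma norm_Lambda_le z1 z2 : Lambda omega f ->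
  `|f z1 - f z2| <= (fine (Lambda_norm omega f) * omega (rnorm (val z1 - val z2)))%:C%C.
Proof.
move=> fL; have fin : Lambda_norm omega f \is a fin_num.
  by rewrite ge0_fin_numE // Lambda_norm_ge0.
have [->|z12] := eqVneq z1 z2.
  by rewrite !subrr normr0 /rnorm normr0 /= (modulus0 w) mulr0.
rewrite -rnormE lecR.
have z0 : 0 < rnorm (val z1 - val z2).
  by rewrite -ltcR rnormE normr_gt0 subr_eq0 (inj_eq val_inj).
rewrite -ler_pdivrMr ?(modulus_gt0 w) // -lee_fin fineK //.
by apply: ereal_sup_ubound; exists (z1, z2) => //=; exact/eqP.
Qed.

End LambdaNorm.

(** * Choice of the dyadic scale and the final inequality *)

Lemma dyadic_bracket {R : realType} (x : R) : 0 < x -> x <= 2 ->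
  exists K : nat, (2 ^+ K)^-1 <= x /\ x <= 2 / 2 ^+ K.
Proof.
move=> x0 x2.
have ex : exists k : nat, (2 ^+ k)^-1 <= x.
  exists (Num.truncn x^-1).+1; rewrite invf_ple ?posrE ?exprn_gt0 //.
  apply/ltW; apply: lt_trans (truncnS_gt _) _.
  by rewrite -natrX ltr_nat ltn_expl.
(* For the least exponent, minimality gives the upper bound; if it is 0, the upper bound is the
   hypothesis [x <= 2]. *)
exists (ex_minn ex); case: ex_minnP => -[|k] kx kmin; split=> //.
  by rewrite expr0 divr1.
rewrite exprS invfM mulrA mulfV ?mul1r //; rewrite leNgt; apply/negP => h.
by have := kmin k (ltW h); rewrite ltnn.
Qed.

Theorem theorem7p6 (R : realType) :
  exists c : R, 0 < c /\
    forall omega : R -> R, modulus_of_continuity omega ->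
    forall f : circle R -> R[i], Lambda omega f ->
    forall (H : completeNormedModType R[i]) (dot : {dot H for conjC}),
      norm_from_dot dot ->
    forall U V : unitary dot,
      (opnorm (fun x : H => fun_calculus f U x - fun_calculus f V x)%R
       <= c%:E * Lambda_norm omega f
          * omega_star omega (fine (opnorm (fun x : H => U x - V x)%R)))%E.
Proof.
have c0 : 0 < 160 + 2400 :> R by apply: addr_gt0; rewrite ltr0n.
exists (160 + 2400); split; first exact: c0.
move=> omega w f fL H dot normE U V.
have Lfin : Lambda_norm omega f \is a fin_num.
  by rewrite ge0_fin_numE // (Lambda_norm_ge0 f w).
set Lam := fine (Lambda_norm omega f).
have Lam0 : 0 <= Lam by rewrite fine_ge0 // (Lambda_norm_ge0 f w).
have fL' z1 z2 := norm_Lambda_le w z1 z2 fL.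
have UVd := norm_unitaryB_le_opnorm normE U V.
set delta := fine _ in UVd *.
have d0 : 0 <= delta by rewrite fine_ge0 // opnorm_ge0.
have d2 : delta <= 2.
  by rewrite -lee_fin fineK ?(opnorm_unitaryB_fin normE) // (opnorm_unitaryB_le2 normE).
(* The scale [K] is left free: it is bracketed by [delta] when [delta > 0] and arbitrarily large
   when [delta = 0]. *)
have key K x : `|x| <= 1 -> rnorm (fun_calculus f U x - fun_calculus f V x) <=
    Lam * (40 * omega (2 ^+ K)^-1 +
           600 * (delta * \sum_(k < K) 2 ^+ k * omega (2 ^+ k)^-1)).
  move=> x1; rewrite -lecR rnormE.
  apply: le_trans (norm_fun_calculusB_le normE w Lam0 fL' K x d0 UVd) _.
  apply: ler_piMr; last exact: x1.
  rewrite ler0c; apply: mulr_ge0; first exact: Lam0.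
  have wK k : 0 <= omega (2 ^+ k)^-1.
    by rewrite (modulus_ge0 w) // invr_ge0 exprn_ge0.
  apply: addr_ge0; first by apply: mulr_ge0; [exact: ler0n | exact: wK].
  apply: mulr_ge0; first exact: ler0n.
  apply: mulr_ge0; first exact: d0.
  by apply: sumr_ge0 => k _; rewrite mulr_ge0 ?exprn_ge0.
apply: ge_ereal_sup => _ [x /= x1 <-].
(* For [delta = 0] the dyadic sum disappears and [omega(2^-K)] is made arbitrarily small, matching
   [omega_star omega 0 = 0]. *)
have [dz|dn] := eqVneq delta 0.
  rewrite dz /omega_star eqxx mule0 lee_fin; apply/ler_addgt0Pr => e e0.
  have e1 : 0 < e / (40 * Lam + 1) by rewrite divr_gt0 // ltr_wpDl // mulr_ge0 ?ler0n.
  have [K KE] := modulus_small w e1.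
  apply: le_trans (key K x x1) _; rewrite dz mul0r mulr0 addr0 add0r.
  have := KE; rewrite ler_pdivlMr; last by rewrite ltr_wpDl // mulr_ge0 ?ler0n.
  have : 0 <= omega (2 ^+ K)^-1 by rewrite (modulus_ge0 w) // invr_ge0 exprn_ge0.
  nra.
have dp : 0 < delta by rewrite lt_def dn.
have [K [K1 K2]] := dyadic_bracket dp d2.
apply: (@le_trans _ _ (Lam%:E * ((160 + 2400)%:E * omega_star omega delta))%E).
  apply: le_trans (lee_wpmul2l _ (dyadic_sum_le_omega_star w dp K1 K2)).
    by rewrite -EFinM lee_fin; exact: key.
  by rewrite lee_fin.
by rewrite /Lam fineK // muleA [X in (X * _)%E]muleC lexx.
Qed.
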